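(* Let $A,A'\subset\mathbb{R}^d$ be closed sets and let $B\subset\mathbb{R}^d$ be an open set such that $A\cap B=A'\cap B$. Let $s\in[0,d)$. (i) If the local Minkowski contents $\mu^s(A,\cdot)$ and $\mu^s(A',\cdot)$ exist, then $\mu^s(A,C)=\mu^s(A',C)$ for any Borel set $C\subset B$. (ii) Similarly, if the local S-contents $\sigma^s(A,\cdot)$ and $\sigma^s(A',\cdot)$ exist, then $\sigma^s(A,C)=\sigma^s(A',C)$ for any Borel set $C\subset B$.
   Context: $\lambda_d$ is Lebesgue measure and $\mathcal{H}^{d-1}$ is $(d-1)$-dimensional Hausdorff measure on $\mathbb{R}^d$; $A_r:=\{z\in\mathbb{R}^d:d(z,A)<r\}$ and $\partial (A_r)$ is its boundary. Let $\kappa_t:=\pi^{t/2}/\Gamma(1+t/2)$. For a closed set $A$, $r>0$ and $0\le s<d$ define Radon measures on $\mathbb{R}^d$ by $$\mu_r^s(A,\cdot):=\frac{\lambda_d(A_r\cap\cdot)}{\kappa_{d-s}r^{d-s}},\qquad \sigma_r^s(A,\cdot):=\frac{\mathcal H^{d-1}(\partial(A_r)\cap\cdot)}{(d-s)\kappa_{d-s}r^{d-s-1}}.$$ The $s$-dimensional local Minkowski content $\mu^s(A,\cdot)$ is the vague limit of $\mu_r^s(A,\cdot)$ as $r\searrow0$, and the $s$-dimensional local S-content $\sigma^s(A,\cdot)$ is the vague limit of $\sigma_r^s(A,\cdot)$ as $r\searrow0$, whenever these limits exist as Radon measures (vague convergence: convergence of integrals of all continuous compactly supported functions on $\mathbb{R}^d$).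 *)

(* Defs.v *)
From HB Require Import structures.
From mathcomp Require Import all_boot all_order all_algebra.
From mathcomp Require Import all_classical all_reals all_analysis.
Set Implicit Arguments.
Unset Strict Implicit.
Unset Printing Implicit Defensive.
Import Order.TTheory GRing.Theory Num.Theory.
Import numFieldNormedType.Exports.
Local Open Scope classical_set_scope.
Local Open Scope ring_scope.

(* R^d is 'rV[R]_d.  Its library norm is the sup norm, so the Euclidean norm is
   defined here; both norms induce the library topology of 'rV[R]_d. *)
Definition enorm (R : realType) (d : nat) (v : 'rV[R]_d) : R :=
  Num.sqrt (\sum_(i < d) v ord0 i ^+ 2).

Definition borelrV (R : realType) (d : nat) :=
  g_sigma_algebraType (@open 'rV[R]_d).

(* d(z, A), with the convention d(z, set0) = +oo. *)
Definition dist_set (R : realType) (d : nat) (z : 'rV[R]_d) (A : set 'rV[R]_d)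
    : \bar R :=
  ereal_inf [set (enorm (z - a))%:E | a in A].

Definition parallel_set (R : realType) (d : nat) (A : set 'rV[R]_d) (r : R)
    : set 'rV[R]_d :=
  [set z | (dist_set z A < r%:E)%E].

Definition boundary (T : topologicalType) (A : set T) : set T :=
  closure A `\` interior A.

Definition Gamma (R : realType) (x : R) : R :=
  \int[lebesgue_measure]_(t in `]0, +oo[) (t `^ (x - 1) * expR (- t)).

Definition kappa (R : realType) (t : R) : R :=
  pi `^ (t / 2) / Gamma (1 + t / 2).

(* Lebesgue (outer) measure on R^d, via countable covers by half-open boxes;
   only its values on Borel sets, where it is a measure, are used. *)
Definition box (R : realType) (d : nat) (a b : 'rV[R]_d) : set 'rV[R]_d :=
  [set x | forall i, a ord0 i <= x ord0 i < b ord0 i].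

Definition box_cover (R : realType) (d : nat) (E : set 'rV[R]_d)
    : set (nat -> 'rV[R]_d * 'rV[R]_d) :=
  [set Q : nat -> 'rV[R]_d * 'rV[R]_d |
           (forall k i, (Q k).1 ord0 i <= (Q k).2 ord0 i) /\
           E `<=` \bigcup_k box (Q k).1 (Q k).2].

Definition lebesgue_rV (R : realType) (d : nat) (E : set 'rV[R]_d) : \bar R :=
  ereal_inf [set (\sum_(0 <= k <oo)
                   (\prod_(i < d) ((Q k).2 ord0 i - (Q k).1 ord0 i))%:E)%E
            | Q in box_cover E].

(* Hausdorff (outer) measure of dimension t, normalized by kappa_t / 2^t so that
   for t = d it is Lebesgue measure on R^d (and for t = 0 counting measure); only
   its values on Borel sets, where it is a measure, are used. *)
Definition diam (R : realType) (d : nat) (U : set 'rV[R]_d) : \bar R :=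
  ereal_sup [set (enorm (xy.1 - xy.2))%:E | xy in U `*` U].

(* The empty set contributes 0 even for t = 0, where x `^ 0 = 1 for all x. *)
Definition hausdorff_gauge (R : realType) (d : nat) (t : R) (U : set 'rV[R]_d)
    : \bar R :=
  if `[< U = set0 >] then 0%E
  else ((kappa t)%:E * (diam U * (2^-1)%:E) `^ t)%E.

Definition hausdorff_delta (R : realType) (d : nat) (t delta : R)
    (E : set 'rV[R]_d) : \bar R :=
  ereal_inf [set (\sum_(0 <= k <oo) hausdorff_gauge t (U k))%E
            | U in [set U : nat -> set 'rV[R]_d |
                     (forall k, (diam (U k) <= delta%:E)%E) /\
                     E `<=` \bigcup_k U k]].

Definition hausdorff_measure (R : realType) (d : nat) (t : R)
    (E : set 'rV[R]_d) : \bar R :=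
  ereal_sup [set hausdorff_delta t delta E | delta in [set delta : R | 0 < delta]].

Definition minkowski_r (R : realType) (d : nat) (s : R) (A : set 'rV[R]_d)
    (r : R) (C : set (borelrV R d)) : \bar R :=
  (lebesgue_rV (parallel_set A r `&` C)
   * ((kappa (d%:R - s) * r `^ (d%:R - s))^-1)%:E)%E.

Definition surface_r (R : realType) (d : nat) (s : R) (A : set 'rV[R]_d)
    (r : R) (C : set (borelrV R d)) : \bar R :=
  (hausdorff_measure (d%:R - 1) (boundary (parallel_set A r) `&` C)
   * (((d%:R - s) * kappa (d%:R - s) * r `^ (d%:R - s - 1))^-1)%:E)%E.

(* On R^d, a Borel measure that is finite on compact sets is Radon. *)
Definition radon (R : realType) (d : nat)
    (mu : {measure set (borelrV R d) -> \bar R}) : Prop :=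
  forall K : set 'rV[R]_d, compact K -> (mu K < +oo)%E.

Definition compactly_supported (R : realType) (d : nat) (f : 'rV[R]_d -> R)
    : Prop :=
  compact (closure [set x | f x != 0]).

(* The integral of the library is defined for any set function; it only evaluates
   nu r on Borel sets. *)
Definition vague_limit0 (R : realType) (d : nat)
    (nu : R -> set (borelrV R d) -> \bar R)
    (mu : {measure set (borelrV R d) -> \bar R}) : Prop :=
  forall f : 'rV[R]_d -> R, continuous f -> compactly_supported f ->
    (\int[nu r]_(x in [set: borelrV R d]) (f x)%:E)%E @[r --> 0^'+] -->
    (\int[mu]_(x in [set: borelrV R d]) (f x)%:E)%E.

(* "mu^s(A, .) exists and equals mu" and "sigma^s(A, .) exists and equals mu". *)
Definition is_local_minkowski_content (R : realType) (d : nat) (s : R)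
    (A : set 'rV[R]_d) (mu : {measure set (borelrV R d) -> \bar R}) : Prop :=
  radon mu /\ vague_limit0 (minkowski_r s A) mu.

Definition is_local_S_content (R : realType) (d : nat) (s : R)
    (A : set 'rV[R]_d) (mu : {measure set (borelrV R d) -> \bar R}) : Prop :=
  radon mu /\ vague_limit0 (surface_r s A) mu.

(* Main.v *)
Require Import Defs.
From HB Require Import structures.
From mathcomp Require Import all_boot all_order all_algebra.
From mathcomp Require Import all_classical all_reals all_analysis.
From mathcomp Require Import measurable_realfun.
Set Implicit Arguments.
Unset Strict Implicit.
Unset Printing Implicit Defensive.
Import Order.TTheory GRing.Theory Num.Theory.
Import numFieldNormedType.Exports.
Local Open Scope classical_set_scope.
Local Open Scope ring_scope.

(** Whether [z] lies in the parallel set [A_r] depends only on [A] within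
    distance [r] of [z]. Hence, on an open set [W] that stays at distance at
    least [e] from the complement of [B], the sets [A_r] and [A'_r] coincide for
    all [r <= e] ([parallel_set_eqI]), and so do their topological boundaries,
    membership in a boundary being a local property ([boundary_local]). The
    normalized volumes and surface measures of [A] and [A'] therefore agree on
    all subsets of [W] as soon as [r <= e].

    Consequently, a test function that vanishes off [W] has the same integrals
    at parameter [r] for [A] and for [A'] ([integral_local]), and, passing to the
    limit, the same integrals against the two contents. To conclude that the
    contents agree on [B], an open [V] contained in [B] is exhausted by an
    increasing sequence of compact sets [K n], each contained in the interior of
    the next. Urysohn's lemma gives a test function [f] between the indicators
    of [K n] and of the interior of [K n.+1] ([exhaustion_bump]), whence
    [mu (K n) <= \int f dmu = \int f dmu' <= mu' V], and continuity from below
    yields [mu V <= mu' V] ([eventually_local_sub]). By symmetry the contents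
    agree on the open subsets of [B]. These form a pi-system, and a Radon measure
    is finite on bounded sets, so the uniqueness theorem for measures extends
    the equality to all Borel subsets of [B] ([eventually_local_eq]). Both parts
    of the theorem are instances of this last statement. *)

(** * Locality of parallel sets and of boundaries *)

(** Parallel sets are built from the Euclidean norm but neighbourhoods from the
    sup norm: with this bound, a point at Euclidean distance less than [r] from
    [x] lies in [ball x r]. *)
Lemma norm_le_enorm (R : realType) (d : nat) (v : 'rV[R]_d) : `|v| <= enorm v.
Proof.
rewrite [leLHS]/Num.norm /= mx_normrE; apply: bigmax_le => [|[i j] _ /=].
  exact: sqrtr_ge0.
rewrite ord1 -sqrtr_sqr ler_sqrt; last by apply: sumr_ge0 => k _; exact: sqr_ge0.
by rewrite (bigD1 j) //= lerDl; apply: sumr_ge0 => k _; exact: sqr_ge0.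
Qed.

(** A point of [A] that witnesses [x \in A_r] is at distance less than [r <= e]
    from [x], hence in [B], hence in [A']. *)
Lemma parallel_set_local (R : realType) (d : nat) (A A' B : set 'rV[R]_d)
    (e r : R) (x : 'rV[R]_d) :
  A `&` B `<=` A' -> r <= e -> ball x e `<=` B ->
  parallel_set A r x -> parallel_set A' r x.
Proof.
move=> AB re xB; rewrite /parallel_set /=.
move=> /ereal_inf_lt[_ [a Aa <-]]; rewrite lte_fin => xa.
apply: le_lt_trans (_ : _ <= (enorm (x - a))%:E)%E _; last by rewrite lte_fin.
apply: ereal_inf_lbound; exists a => //; apply: AB; split=> //.
apply: xB; rewrite -ball_normE /=.
exact: le_lt_trans (norm_le_enorm _) (lt_le_trans xa re).
Qed.

Lemma parallel_set_eqI (R : realType) (d : nat) (A A' B W : set 'rV[R]_d)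
    (e r : R) : A `&` B = A' `&` B -> r <= e ->
  (forall x, W x -> ball x e `<=` B) ->
  parallel_set A r `&` W = parallel_set A' r `&` W.
Proof.
move=> AB re WB; apply/seteqP; split=> x [Arx Wx]; split=> //.
- by apply: parallel_set_local (WB x Wx) Arx => //; rewrite AB; exact: subIsetl.
- by apply: parallel_set_local (WB x Wx) Arx => //; rewrite -AB; exact: subIsetl.
Qed.

Lemma boundary_local (T : topologicalType) (P Q W : set T) : open W ->
  P `&` W = Q `&` W -> boundary P `&` W = boundary Q `&` W.
Proof.
move=> oW.
suff sub P' Q' : P' `&` W = Q' `&` W -> boundary P' `&` W `<=` boundary Q' `&` W.
  by move=> PQ; apply/seteqP; split; apply: sub.
move=> PQ x [[clx intx] Wx]; have nW : nbhs x W by exact: open_nbhs_nbhs.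
split=> //; split.
- move=> U nU; have [y [P'y [Uy Wy]]] := clx _ (filterI nU nW).
  by exists y; split=> //; have : (P' `&` W) y by []; rewrite PQ => -[].
- move=> nQ; apply: intx; apply: filterS (filterI nQ nW).
  by move=> y; rewrite -PQ => -[].
Qed.

(** * Integrals against set functions *)

Section raw_integral.
Local Open Scope ereal_scope.
Import HBNNSimple.

(** [nu] and [nu'] are arbitrary set functions, because the rescaled volumes and
    surface measures are given as outer measures. The integral is a supremum of sums
    [y * nu (h @^-1` [set y])] over simple functions [h] below [f]; for
    [y != 0] the level set lies in [W], and for [y = 0] the summand vanishes
    whatever the value of [nu]. *)
Lemma integral_local (dT : measure_display) (T : measurableType dT)
    (R : realType) (nu nu' : set T -> \bar R) (W : set T) (f : T -> \bar R) :
  (forall S, S `<=` W -> nu S = nu' S) -> (forall x, ~ W x -> f x = 0) ->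
  \int[nu]_(x in [set: T]) f x = \int[nu']_(x in [set: T]) f x.
Proof.
move=> nuW f0; rewrite /integral patch_setT.
suff eq_sup (g : T -> \bar R) : (forall x, ~ W x -> g x = 0) ->
    ereal_sup [set sintegral nu h |
      h in [set h : {nnsfun T >-> R} | forall x, (h x)%:E <= g x]] =
    ereal_sup [set sintegral nu' h |
      h in [set h : {nnsfun T >-> R} | forall x, (h x)%:E <= g x]].
  by congr (_ - _); apply: eq_sup => x Wx;
     rewrite ?funeposE ?funenegE f0 ?oppe0 ?maxxx.
move=> g0; congr ereal_sup; apply: eq_imagel => h /= hg.
apply: eq_fsbigr => y _; have [->|y0] := eqVneq y 0%R; first by rewrite !mul0e.
congr (_ * _); apply: nuW => x /= hxy; apply: contrapT => Wx.
have := hg x; rewrite g0// lee_fin => h0; move/negP: y0; apply.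
by rewrite -hxy eq_le h0; exact: fun_ge0.
Qed.

End raw_integral.

(** * Exhaustion of an open set by compact sets *)

Section exhaustion.
Variables (R : realType) (d : nat).
Implicit Types V : set 'rV[R]_d.

(** Distance at least [1 / n.+1] to the complement of [V] is phrased as not lying
    in a union of open balls, so that closedness is immediate and [V = setT]
    needs no convention for the distance to the empty set. *)
Definition exhaustion V (n : nat) : set 'rV[R]_d :=
  [set x | `|x| <= n.+1%:R] `\` \bigcup_(y in ~` V) ball y n.+1%:R^-1.

Lemma exhaustion_ball V n x : exhaustion V n x -> ball x n.+1%:R^-1 `<=` V.
Proof.
move=> [_ xV] y xy; apply: contrapT => Vy; apply: xV.
by exists y => //; exact: ball_sym.
Qed.

Lemma exhaustion_sub V n : exhaustion V n `<=` V.
Proof. by move=> x /exhaustion_ball; apply; apply: ballxx; rewrite invr_gt0. Qed.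

Lemma compact_exhaustion V n : compact (exhaustion V n).
Proof.
apply: bounded_closed_compact.
  exists n.+1%:R; split; first exact: num_real.
  by move=> M nM x [xn _]; exact: le_trans xn (ltW nM).
rewrite /exhaustion setDE; apply: closedI.
  rewrite (_ : [set x | _] =
    (fun x : 'rV[R]_d => `|x|) @^-1` [set r | r <= n.+1%:R]) //.
  by apply: closed_comp => [x _|]; [exact: norm_continuous|exact: closed_le].
by apply: open_closedC; apply: bigcup_open => y _; exact: ball_open.
Qed.

(** The gap between [1 / n.+1] and [1 / n.+2] is room for a ball around each
    point; this is what allows separating [exhaustion V n] from the complement of
    the interior of [exhaustion V n.+1]. *)
Lemma exhaustion_interior V n :
  exhaustion V n `<=` (exhaustion V n.+1)°.
Proof.
move=> x [xn xV].
pose e : R := n.+1%:R^-1 - n.+2%:R^-1.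
have e0 : 0 < e by rewrite subr_gt0 ltf_pV2 ?posrE// ltr_nat.
apply/nbhs_ballP; exists e => //= z xz; split=> /=.
  have ze : `|x - z| < e by move: xz; rewrite -ball_normE.
  (* The norm may grow by at most e, and the next bound on it is larger by 1. *)
  have e1 : e <= 1.
    by rewrite lerBlDr (le_trans (_ : _ <= 1)) ?lerDl ?invr_ge0// invf_le1 ?ler1n.
  rewrite -[n.+2%:R]natr1 -[z](subKr x) (le_trans (ler_normB _ _)) ?lerD//.
  exact: le_trans (ltW ze) e1.
move=> [y Vy yz]; apply: xV; exists y => //.
have -> : n.+1%:R^-1 = n.+2%:R^-1 + e :> R by rewrite /e addrC subrK.
exact: ball_triangle yz (ball_sym xz).
Qed.

Lemma nondecreasing_exhaustion V : nondecreasing_seq (exhaustion V).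
Proof.
apply/nondecreasing_seqP => n; apply/subsetPset.
exact: subset_trans (@exhaustion_interior V n) (@interior_subset _ _).
Qed.

Lemma bigcup_exhaustion V : open V -> \bigcup_n exhaustion V n = V.
Proof.
move=> oV; apply/seteqP; split=> [x [n _]|x Vx]; first exact: exhaustion_sub.
have /nbhs_ballP[e /= e0 eV] : nbhs x V by exact: open_nbhs_nbhs.
have [k ke] := ltr_add_invr e0; rewrite add0r in ke.
(* k controls the distance to the complement of V, the other index the norm. *)
pose n := maxn k (Num.truncn `|x|); exists n => //; split=> /=.
  apply: ltW (lt_le_trans (truncnS_gt `|x|) _).
  by rewrite ler_nat ltnS leq_maxr.
move=> [y Vy yx]; apply: Vy; apply: eV; apply: le_ball (ball_sym yx).
apply: le_trans (ltW ke).
by rewrite lef_pV2 ?posrE// ler_nat ltnS leq_maxl.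
Qed.

(** Vanishing off the interior of the next set makes the support a closed subset
    of a compact set, and places the nonzero values in an open set that is
    uniformly far from the complement of [V]. *)
Lemma exhaustion_bump V n : exists f : 'rV[R]_d -> R,
  [/\ continuous f, compactly_supported f, forall x, 0 <= f x <= 1,
      forall x, exhaustion V n x -> f x = 1 &
      forall x, ~ (exhaustion V n.+1)° x -> f x = 0].
Proof.
have clK k : closed (exhaustion V k).
  by apply: compact_closed; [exact: norm_hausdorff|exact: compact_exhaustion].
have : uniform_separator (~` (exhaustion V n.+1)°) (exhaustion V n).
  apply: (@normal_separatorP R _).1 => //; first exact: pseudometric_normal.
    exact/open_closedC/open_interior.
  by apply/disjoints_subset/subsetC; exact: exhaustion_interior.
move=> /(@uniform_separatorP _ R)[f [cf f01 f0 f1]]; exists f.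
have f0' x : ~ (exhaustion V n.+1)° x -> f x = 0 by move=> xK; apply: f0; exists x.
split=> //.
- apply: subclosed_compact (@closed_closure _ _) (@compact_exhaustion V n.+1) _.
  rewrite [X in _ `<=` X](closure_id _).1//; apply: closureS => x /= fx.
  apply: interior_subset; apply: contrapT => /f0' fx0.
  by rewrite fx0 eqxx in fx.
- by move=> x; have /= := f01 (f x) (imageT _ _); rewrite in_itv.
- by move=> x Kx; apply: f1; exists x.
Qed.

End exhaustion.

(** * Comparison of vague limits *)

Section vague_limits.
Variables (R : realType) (d : nat).
Local Open Scope ereal_scope.

Lemma open_measurable_borelrV (U : set 'rV[R]_d) :
  open U -> measurable (U : set (borelrV R d)).
Proof. exact: sub_sigma_algebra. Qed.

Lemma compact_measurable_borelrV (K : set 'rV[R]_d) :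
  compact K -> measurable (K : set (borelrV R d)).
Proof.
move=> /(compact_closed (@norm_hausdorff _ _)) /closed_openC oK.
rewrite -[K]setCK; apply: measurableC; exact: open_measurable_borelrV.
Qed.

Lemma continuous_measurable_borelrV (f : 'rV[R]_d -> R) :
  continuous f ->
  measurable_fun [set: borelrV R d] (f : borelrV R d -> R).
Proof.
move=> cf.
apply: (measurability _ (RGenOInfty.measurableE R)).
move=> _ [_ [a ->] <-]; rewrite setTI; apply: open_measurable_borelrV.
by apply: open_comp => [x _|]; [exact: cf|exact: interval_open].
Qed.

(** The values of the two measures are bounded by integrals of one test function
    from above and from below, so that equality of these integrals, which is all
    that vague limits give, transfers to an inequality between the measures. *)
Lemma exhaustion_le (mu mu' : {measure set (borelrV R d) -> \bar R})
    (V : set 'rV[R]_d) (n : nat) (f : 'rV[R]_d -> R) : open V ->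
  continuous f -> (forall x, (0 <= f x <= 1)%R) ->
  (forall x, exhaustion V n x -> f x = 1%R) ->
  (forall x, ~ V x -> f x = 0%R) ->
  \int[mu]_(x in [set: borelrV R d]) (f x)%:E =
    \int[mu']_(x in [set: borelrV R d]) (f x)%:E ->
  mu (exhaustion V n) <= mu' V.
Proof.
move=> oV cf f01 f1 f0 eqf.
have mK := compact_measurable_borelrV (@compact_exhaustion R d V n).
have mV := open_measurable_borelrV oV.
rewrite -[X in mu X]setIT -integral_indic//.
rewrite -[X in _ <= mu' X]setIT -integral_indic//.
have mf := (measurable_EFinP _ _).2 (continuous_measurable_borelrV cf).
apply: (@le_trans _ _ (\int[mu]_(x in [set: borelrV R d]) (f x)%:E)).
  apply: ge0_le_integral => //=.
  - by apply/measurable_EFinP; exact: measurable_indic.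
  - move=> x _; rewrite lee_fin indicE.
    have [/set_mem/f1 ->|_] := boolP (x \in exhaustion V n); first by [].
    by have /andP[] := f01 x.
rewrite eqf; apply: ge0_le_integral => //=.
- by move=> x _; rewrite lee_fin; have /andP[] := f01 x.
- by apply/measurable_EFinP; exact: measurable_indic.
- move=> x _; rewrite lee_fin indicE.
  have [_|/negP xV] := boolP (x \in V); first by have /andP[] := f01 x.
  by rewrite f0// => /mem_set.
Qed.

(** The hypothesis says that [nu r] and [nu' r] eventually agree on the subsets
    of any open set staying at positive distance from the complement of [B]; the
    meaning of eventually may depend on that open set, which suffices since each
    test function involves only one of them. *)
Lemma eventually_local_sub (nu nu' : R -> set (borelrV R d) -> \bar R)
    (mu mu' : {measure set (borelrV R d) -> \bar R}) (B V : set 'rV[R]_d) :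
  (forall (e : R) (W : set 'rV[R]_d), (0 < e)%R -> open W ->
    (forall x, W x -> ball x e `<=` B) ->
    \forall r \near 0^'+, forall S, S `<=` W -> nu r S = nu' r S) ->
  vague_limit0 nu mu -> vague_limit0 nu' mu' -> open V -> V `<=` B ->
  mu V <= mu' V.
Proof.
move=> loc numu numu' oV VB.
have mK n := compact_measurable_borelrV (@compact_exhaustion R d V n).
have KV := bigcup_exhaustion oV.
have cvgK : mu (exhaustion V n) @[n --> \oo] --> mu V.
  rewrite -[X in _ --> mu X]KV; apply: nondecreasing_cvg_mu => //.
    by rewrite KV; exact: open_measurable_borelrV.
  exact: nondecreasing_exhaustion.
rewrite -(cvg_lim (@ereal_hausdorff _) cvgK); apply: lime_le.
  by apply/cvg_ex; exists (mu V).
near=> n; have [f [cf csf f01 f1 f0]] := exhaustion_bump V n.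
apply: (exhaustion_le oV cf f01 f1) => [x Vx|].
  by apply: f0 => /interior_subset/exhaustion_sub.
have loc_n : \forall r \near 0^'+,
    forall S, S `<=` (exhaustion V n.+1)° -> nu r S = nu' r S.
  apply: (loc (n.+2%:R^-1)%R); [by []|exact: open_interior|].
  by move=> x /interior_subset/exhaustion_ball/subset_trans; apply.
apply: (@cvg_unique _ (@ereal_hausdorff R) _ _ _ _ (numu f cf csf)).
apply: cvg_trans (near_eq_cvg _) (numu' f cf csf).
near=> r; apply: esym;
  apply: (@integral_local _ (borelrV R d) _ _ _ (exhaustion V n.+1)°).
  by near: r.
by move=> x /f0 ->.
Unshelve. all: by end_near. Qed.

(** The measures are restricted to [B] and compared on the pi-system of all open
    sets, covered by the bounded balls around the origin on which a Radon measure
    is finite. *)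
Lemma eventually_local_eq (nu nu' : R -> set (borelrV R d) -> \bar R)
    (mu mu' : {measure set (borelrV R d) -> \bar R}) (B : set 'rV[R]_d) :
  open B ->
  (forall (e : R) (W : set 'rV[R]_d), (0 < e)%R -> open W ->
    (forall x, W x -> ball x e `<=` B) ->
    \forall r \near 0^'+, forall S, S `<=` W -> nu r S = nu' r S) ->
  radon mu -> vague_limit0 nu mu -> vague_limit0 nu' mu' ->
  forall C : set (borelrV R d), measurable C -> C `<=` B -> mu C = mu' C.
Proof.
move=> oB loc radmu numu numu' C mC CB.
have loc' (e : R) (W : set 'rV[R]_d) : (0 < e)%R -> open W ->
    (forall x, W x -> ball x e `<=` B) ->
    \forall r \near 0^'+, forall S, S `<=` W -> nu' r S = nu r S.
  by move=> e0 oW WB; apply: filterS (loc e W e0 oW WB) => r nuW S /nuW.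
have mB := open_measurable_borelrV oB.
have mb k : measurable (ball (0%R : 'rV[R]_d) k.+1%:R : set (borelrV R d)).
  by apply: open_measurable_borelrV; exact: ball_open.
pose muB : {measure set (borelrV R d) -> \bar R} := mrestr mu mB.
pose muB' : {measure set (borelrV R d) -> \bar R} := mrestr mu' mB.
suff : muB C = muB' C by rewrite /= /mrestr setIidl.
apply: (@measure_unique _ _ (borelrV R d) (@open 'rV[R]_d)
  (fun k => ball 0%R k.+1%:R)) => //.
- by move=> U V oU oV; exact: openI.
- by move=> k; exact: ball_open.
- apply/seteqP; split=> // x _; exists (Num.truncn `|x|) => //.
  by rewrite -ball_normE /= sub0r normrN; exact: truncnS_gt.
- move=> U oU; rewrite /= /mrestr; have oUB : open (U `&` B) by exact: openI.
  apply/eqP; rewrite eq_le; apply/andP; split.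
    exact: (eventually_local_sub loc).
  exact: (eventually_local_sub loc').
- move=> k; rewrite /= /mrestr.
  have cK : compact [set x : 'rV[R]_d | (`|x| <= k.+1%:R)%R].
    (* For V = setT the exhaustion consists of closed balls. *)
    have := @compact_exhaustion R d setT k.
    by rewrite /exhaustion setCT bigcup_set0 setD0.
  apply: le_lt_trans (radmu _ cK); apply: le_measure; rewrite ?inE.
  + exact: measurableI.
  + exact: compact_measurable_borelrV.
  + by move=> x []; rewrite -ball_normE /= sub0r normrN => /ltW.
Qed.

End vague_limits.

(** * Locality of the contents *)

Theorem proposition4p9 (R : realType) (d : nat) (A A' B : set 'rV[R]_d)
    (clA : closed A) (clA' : closed A') (oB : open B)
    (AB : A `&` B = A' `&` B) (s : R) (s_ge0 : 0 <= s) (s_ltd : s < d%:R) :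
  (forall mu mu' : {measure set (borelrV R d) -> \bar R},
      is_local_minkowski_content s A mu ->
      is_local_minkowski_content s A' mu' ->
      forall C : set (borelrV R d), measurable C -> C `<=` B -> mu C = mu' C) /\
  (forall sigma sigma' : {measure set (borelrV R d) -> \bar R},
      is_local_S_content s A sigma ->
      is_local_S_content s A' sigma' ->
      forall C : set (borelrV R d), measurable C -> C `<=` B ->
        sigma C = sigma' C).
Proof.
have PW e W r : r < e -> (forall x, W x -> ball x e `<=` B) ->
    parallel_set A r `&` W = parallel_set A' r `&` W.
  by move=> /ltW; exact: parallel_set_eqI.
have setI_eqS (P Q S W : set 'rV[R]_d) :
    S `<=` W -> P `&` W = Q `&` W -> P `&` S = Q `&` S.
  by move=> /setIidr <-; rewrite !setIA => ->.
split=> mu mu' [radmu numu] [_ numu'];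
  apply: (eventually_local_eq oB _ radmu numu numu') => e W e0 oW WB;
  near=> r => S SW; congr (_ * _)%E.
- congr lebesgue_rV; apply: setI_eqS SW _; apply: PW WB.
  by near: r; exact: nbhs_right_lt.
- congr hausdorff_measure; apply: setI_eqS SW _; apply: boundary_local => //.
  apply: PW WB; by near: r; exact: nbhs_right_lt.
Unshelve. all: by end_near. Qed.
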